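(* Let $a,b\in\mathbb{R}$ and let $h$ be the range-angle measurement function $$h(x)=\begin{bmatrix}\sqrt{(x(1)-a)^2+(x(2)-b)^2}\\ \arctan\!\left(\frac{x(2)-b}{x(1)-a}\right)\end{bmatrix},\qquad x=(x(1),x(2))\in\mathbb{R}^2.$$ Let $x\in\mathbb{R}^2$, let $P\in\mathbb{R}^{2\times 2}$ be symmetric positive definite, and let $E=(E_{ij})$ be the Cholesky factor of $P$ ($P=EE^T$). Assume that the set $\{x+Eu: u\in\mathbb{R}^2,\ \|u\|\le 1\}$ does not intersect the ray $\{z\in\mathbb{R}^2: z(1)\le a,\ z(2)=b\}$. Define $$g(u)=h(x+Eu)-h(x)-J_hEu,$$ where $J_h$ is the Jacobian matrix of $h$ at $x$, and set $$c=E_{11}(x(2)-b)-E_{21}(x(1)-a),\qquad d=E_{12}(x(2)-b)-E_{22}(x(1)-a).$$ Then for every $u=(u(1),u(2))\in\mathbb{R}^2$ with $\|u\|\le 1$, the determinant of the derivative (Jacobian matrix) of $g$ at $u$ is $\ge 0$, with equality if and only if $c\,u(1)+d\,u(2)=0$. Moreover, if $c\,u(1)+d\,u(2)=0$, then $g(u)=0$.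
   Context: $\|\cdot\|$ is the Euclidean norm. The Cholesky factor $E$ of $P$ is the lower triangular matrix with positive diagonal entries with $P=EE^T$. In the second component of $h$, $\arctan\left(\frac{x(2)-b}{x(1)-a}\right)$ denotes the four-quadrant angle, i.e. the polar angle in $(-\pi,\pi)$ of the vector $(x(1)-a,x(2)-b)$, which is smooth on the complement of the ray $\{x(1)\le a,\ x(2)=b\}$. The function $g$ is defined and continuously differentiable on an open neighbourhood of the closed unit disc. *)

(* Defs.v *)
From HB Require Import structures.
From mathcomp Require Import all_boot all_order all_algebra.
From mathcomp Require Import all_classical all_reals all_analysis.
From mathcomp Require Import ring lra.
Set Implicit Arguments.
Unset Strict Implicit.
Unset Printing Implicit Defensive.
Import Order.TTheory GRing.Theory Num.Theory.
Import numFieldNormedType.Exports.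
Local Open Scope classical_set_scope.
Local Open Scope ring_scope.

(* Points of R^n are row vectors, as required by the library's [jacobian].
   Hence the column vector E u is written [u *m E^T], and the matrix
   ['J f p] = [jacobian f p], which acts by [v |-> v *m 'J f p], is the
   transpose of the matrix of partial derivatives of f at p.  Components are
   numbered from 0: x(1), x(2) are [x 0 0], [x 0 1]. *)

(* The norm carried by ['rV[R]_n] in the library is the sup norm. *)
Definition enorm (R : realType) (n : nat) (v : 'rV[R]_n) : R :=
  Num.sqrt (\sum_i v 0 i ^+ 2).

Definition closed_unit_ball (R : realType) (n : nat) : set 'rV[R]_n :=
  [set u | enorm u <= 1].

Definition posdefmx (R : realType) (n : nat) (P : 'M[R]_n) : Prop :=
  P^T = P /\ forall v : 'rV[R]_n, v != 0 -> 0 < (v *m P *m v^T) 0 0.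

(* [is_trig_mx] means lower triangular. *)
Definition cholesky_factor (R : realType) (n : nat) (E P : 'M[R]_n) : Prop :=
  [/\ is_trig_mx E, (forall i, 0 < E i i) & P = E *m E^T].

Definition is_polar_angle (R : realType) (p q t : R) : Prop :=
  [/\ - pi < t < pi, p = Num.sqrt (p ^+ 2 + q ^+ 2) * cos t
    & q = Num.sqrt (p ^+ 2 + q ^+ 2) * sin t].

(* Arbitrary on the ray p <= 0, q = 0; elsewhere, see [polar_angleP] and
   [is_polar_angle_inj] below. *)
Definition polar_angle (R : realType) (p q : R) : R :=
  get [set t | is_polar_angle p q t].

Definition excluded_ray (R : realType) (a b : R) : set 'rV[R]_2 :=
  [set z | z 0 0 <= a /\ z 0 1 = b].

Definition range_angle (R : realType) (a b : R) (x : 'rV[R]_2) : 'rV[R]_2 :=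
  \row_i (if i == 0 then Num.sqrt ((x 0 0 - a) ^+ 2 + (x 0 1 - b) ^+ 2)
          else polar_angle (x 0 0 - a) (x 0 1 - b)).

(* The remainder h(x + E u) - h(x) - J_h E u. *)
Definition linearization_error (R : realType) (n m : nat)
    (h : 'rV[R]_n -> 'rV[R]_m) (x : 'rV[R]_n) (E : 'M[R]_n) (u : 'rV[R]_n) :
    'rV[R]_m :=
  h (x + u *m E^T) - h x - u *m E^T *m 'J h x.

Lemma off_ray_norm_gt0 (R : realType) (p q : R) :
  ~ (p <= 0 /\ q = 0) -> 0 < Num.sqrt (p ^+ 2 + q ^+ 2).
Proof.
move=> Hv; rewrite sqrtr_gt0 lt_neqAle addr_ge0 ?sqr_ge0// andbT.
apply/eqP => /esym/eqP; rewrite paddr_eq0 ?sqr_ge0// !sqrf_eq0.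
by move=> /andP[/eqP v0 /eqP v1]; apply: Hv; rewrite v0.
Qed.

Lemma polar_angleP (R : realType) (p q : R) :
  ~ (p <= 0 /\ q = 0) -> is_polar_angle p q (polar_angle p q).
Proof.
move=> Hv; suff: exists t, is_polar_angle p q t by move=> /getPex.
rewrite /is_polar_angle; have := off_ray_norm_gt0 Hv.
have := sqr_sqrtr (addr_ge0 (sqr_ge0 p) (sqr_ge0 q)).
set r := Num.sqrt _ => N2 N0; set k := p / r.
have vk : p = r * k by rewrite mulrC divfK ?gt_eqF.
have k1 : -1 <= k <= 1.
  rewrite -ler_norml -(@expr_le1 _ 2)// real_normK ?num_real//.
  rewrite -(ler_pM2l (exprn_gt0 2 N0)) -exprMn -vk mulr1 N2 lerDl.
  exact: sqr_ge0.
have kN1 : -1 < k.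
  rewrite lt_neqAle; case/andP: k1 => -> _; rewrite andbT; apply/eqP => E.
  have v0 : p = - r by rewrite vk -E mulrN1.
  apply: Hv; split; first by rewrite v0 oppr_le0 ltW.
  by apply/eqP; rewrite -sqrf_eq0; apply/eqP; rewrite v0 sqrrN in N2; lra.
have api : acos k < pi by apply: acos_ltpi; rewrite kN1; case/andP: k1.
have a0 := acos_ge0 k1.
have ck : cos (acos k) = k by apply: acosK; rewrite in_itv.
have sk : r * sin (acos k) = `|q|.
  rewrite sin_acos// -[r in LHS]gtr0_norm// -sqrtr_sqr -sqrtrM ?sqr_ge0//.
  rewrite mulrBr mulr1 -exprMn -vk N2 -sqrtr_sqr; congr Num.sqrt; ring.
case: (lerP 0 q) => v1.
  by exists (acos k); split; rewrite ?ck// ?sk ?ger0_norm//; lra.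
exists (- acos k); split; rewrite ?cosN ?ck// ?sinN ?mulrN ?sk.
  lra.
by rewrite ltr0_norm ?opprK.
Qed.

Lemma is_polar_angle_inj (R : realType) (p q s t : R) :
  ~ (p <= 0 /\ q = 0) -> is_polar_angle p q s -> is_polar_angle p q t -> s = t.
Proof.
move=> Hv; rewrite /is_polar_angle; have := off_ray_norm_gt0 Hv.
set r := Num.sqrt _ => N0 [s1 cs ss] [t1 ct st].
have C : cos s = cos t by apply: (mulfI (lt0r_neq0 N0)); rewrite -cs -ct.
have S : sin s = sin t by apply: (mulfI (lt0r_neq0 N0)); rewrite -ss -st.
have D : cos (s - t) = 1 by rewrite cosB C S -!expr2 cos2Dsin2.
have sh : sin ((s - t) / 2) = 0.
  apply/eqP; rewrite -sqrf_eq0 sin2cos2.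
  have : cos (((s - t) / 2) *+ 2) = 1 by rewrite -mulr_natr divfK.
  by rewrite cos_mulr2n => H; apply/eqP; lra.
case: (ltrgtP s t) => // st'; exfalso.
  have := @sin_gt0_pi _ (- ((s - t) / 2)).
  by rewrite sinN sh oppr0 ltxx => H; suff: false by []; apply: H; lra.
have := @sin_gt0_pi _ ((s - t) / 2).
by rewrite sh ltxx => H; suff: false by []; apply: H; lra.
Qed.

(* Main.v *)
(* Write n, n' for the unit vectors in the directions of x - (a,b) and of
   y - (a,b), where y = x + E u, and r, r' for the two norms.  In rows, the
   Jacobian matrix of h at x consists of n and of n rotated by a right angle and
   divided by r, so that
     det (J_h(y) - J_h(x)) = (1/r + 1/r') (1 - n . n') >= 0,
   with equality iff n = n'.  The quantity c u(1) + d u(2) is the cross product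
   of E u and x - (a,b); it vanishes iff n' = n or n' = -n, and n' = -n is
   impossible since the segment from x to y would contain (a,b).  When n' = n, h
   is affine on the segment from x to y, hence g(u) = 0. *)
Require Import Defs.
From HB Require Import structures.
From mathcomp Require Import all_boot all_order all_algebra.
From mathcomp Require Import all_classical all_reals all_analysis.
From mathcomp Require Import ring lra.
Import Order.TTheory GRing.Theory Num.Theory.
Import numFieldNormedType.Exports.
Local Open Scope classical_set_scope.
Local Open Scope ring_scope.

Set Implicit Arguments.
Unset Strict Implicit.

(** * Differential calculus on spaces of row vectors *)

(** The first-order expansion of [f] at [x] is also one of [g], and such an expansion determines the
    differential. This serves to replace [polar_angle] by a formula valid only near a point. *)
Lemma near_eq_is_diff (R : numFieldType) (V W : normedModType R)
    (f g df : V -> W) (x : V) :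
  (\forall y \near x, f y = g y) -> is_diff x f df -> is_diff x g df.
Proof.
move=> fg [fx dfE].
have gE : g \o shift x = cst (g x) + 'd f x +o_ 0 id.
  apply/eqaddoP => e e0; have /diff_locally/eqaddoP/(_ e e0) := fx.
  have : \forall h \near 0, (f \o shift x) h = (g \o shift x) h.
    by move: fg; rewrite (near_shift 0 x) subr0.
  apply: filterS2 => h /= fgh; rewrite !fctE/= fgh (nbhs_singleton fg).
  exact.
have dgE := diff_unique (diff_continuous fx) gE.
apply: DiffDef; last by rewrite dgE.
by apply/diff_locallyP; rewrite dgE; split=> //; exact: diff_continuous.
Qed.

Lemma is_diff_coord (R : numFieldType) (m n : nat) (M : 'M[R]_(m, n)) i j :
  is_diff M (fun N : 'M[R]_(m, n) => N i j : R) (fun N => N i j).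
Proof.
have lin : linear (fun N : 'M[R]_(m, n) => N i j : R).
  by move=> k A B; rewrite !mxE.
pose coord : {linear 'M[R]_(m, n) -> R} :=
  HB.pack (fun N : 'M[R]_(m, n) => N i j : R)
    (GRing.isLinear.Build _ _ _ _ _ lin).
apply: DiffDef; first exact: differentiable_coord.
exact: (diff_lin (f := coord)) (@coord_continuous R m n i j).
Qed.

(** Differentiability comes from writing [f] as a finite sum of its components times basis vectors;
    the differential is then read off by composing with each coordinate map. *)
Lemma is_diff_row (R : numFieldType) (V : normedModType R) (n : nat)
    (f : V -> 'rV[R]_n) (df : 'I_n -> V -> R) (x : V) :
  (forall i, is_diff x (fun y => f y 0 i : R) (df i)) ->
  is_diff x f (fun v => \row_i df i v).
Proof.
move=> fi.
have fE : f = \sum_i (fun y => f y 0 i *: delta_mx 0 i : 'rV[R]_n).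
  by apply/funext => y; rewrite fct_sumE {1}[f y]row_sum_delta.
have fx : differentiable f x.
  rewrite fE; apply: differentiable_sum => i.
  by apply: differentiableZl; have [] := fi i.
apply: DiffDef => //; apply/funext => v; apply/rowP => i; rewrite mxE.
have [_ <-] := fi i.
have [coordx coordE] := is_diff_coord (f x) 0 i.
by have /(congr1 (@^~ v))/= := diff_comp fx coordx; rewrite coordE.
Qed.

Lemma is_diff_comp_derive (R : numFieldType) (V : normedModType R)
    (f df : V -> R) (phi : R -> R) (d : R) (x : V) :
  is_diff x f df -> is_derive (f x) 1 phi d ->
  is_diff x (fun y => phi (f y)) (fun v => df v * d).
Proof.
move=> fx phid.
have phix : is_diff (f x) phi ( *:%R^~ d).
  apply: DiffDef; first by apply/derivable1_diffP; case: phid.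
  by rewrite deriv1E; [rewrite derive1E derive_val|case: phid].
exact: is_diff_comp.
Qed.

(** * The polar angle and the differential of h *)

(** Always r >= -p, with equality exactly on the ray. This turns the ray condition into an open one,
    and r + p is the denominator of the half-angle formula. *)
Lemma off_rayP (R : realType) (p q : R) :
  ~ (p <= 0 /\ q = 0) <-> 0 < Num.sqrt (p ^+ 2 + q ^+ 2) + p.
Proof.
split=> [H|+ [p0 q0]].
  have := off_ray_norm_gt0 H.
  have := sqr_sqrtr (addr_ge0 (sqr_ge0 p) (sqr_ge0 q)).
  set r := Num.sqrt _ => r2 r0.
  have [p0|p0] := ltP 0 p; first by rewrite addr_gt0.
  have q2 : 0 < q ^+ 2 by rewrite exprn_even_gt0//=; apply/eqP => q0; exact: H.
  by rewrite ltNge; apply/negP => rp; nra.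
by rewrite q0 expr0n addr0 sqrtr_sqr ler0_norm// addNr ltxx.
Qed.

(* Tangent half-angle formula: a single expression valid on the whole
   complement of the ray. *)
Lemma polar_angle_atan (R : realType) (p q : R) : ~ (p <= 0 /\ q = 0) ->
  polar_angle p q = 2 * atan (q / (Num.sqrt (p ^+ 2 + q ^+ 2) + p)).
Proof.
move=> H; apply: (is_polar_angle_inj H (polar_angleP H)).
have /off_rayP := H; have := off_ray_norm_gt0 H; rewrite /is_polar_angle.
have := sqr_sqrtr (addr_ge0 (sqr_ge0 p) (sqr_ge0 q)).
set r := Num.sqrt _ => r2 r0 s0; set t := q / _.
(* Because (r + p)^2 + q^2 = 2 r (r + p). The squared cosine of the half angle follows, and the
   double-angle formulas give the rest. *)
have t2 : 1 + t ^+ 2 = 2 * r / (r + p).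
  by rewrite /t; field: r2; rewrite gt_eqF.
have c2 : cos (atan t) ^+ 2 = (r + p) / (2 * r).
  by rewrite cos_atan exprVn sqr_sqrtr ?addr_ge0 ?sqr_ge0// t2 invf_div.
have c0 : cos (atan t) != 0.
  by rewrite -sqrf_eq0 c2 gt_eqF// divr_gt0// mulr_gt0.
have st : sin (atan t) = t * cos (atan t).
  by rewrite -{2}[t]atanK /tan divfK.
rewrite mulr_natl; split.
- have := atan_gtNpi2 t; have := atan_ltpi2 t => ? ?.
  by rewrite mulr2n; apply/andP; split; lra.
- by rewrite cos_mulr2n c2; field; rewrite gt_eqF.
- rewrite sin_mulr2n st mulrCA -expr2 c2 /t; field.
  by rewrite !gt_eqF.
Qed.

Lemma not_excluded_ray (R : realType) (a b : R) (z : 'rV[R]_2) :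
  ~ excluded_ray a b z <-> ~ (z 0 0 - a <= 0 /\ z 0 1 - b = 0).
Proof.
by rewrite /excluded_ray /= subr_le0; split=> zray [za zb]; apply: zray;
  split=> //; [exact: subr0_eq|rewrite zb subrr].
Qed.

(** It acts on row vectors from the right, so its columns, not its rows, are the gradients of the
    range and of the angle. *)
Definition range_angle_jac (R : realType) (a b : R) (z : 'rV[R]_2) : 'M[R]_2 :=
  let p := z 0 0 - a in let q := z 0 1 - b in
  let r := Num.sqrt (p ^+ 2 + q ^+ 2) in
  \matrix_(i, j) if j == 0 then (if i == 0 then p else q) / r
                 else (if i == 0 then - q else p) / r ^+ 2.

Lemma is_diff_range_angle (R : realType) (a b : R) (z : 'rV[R]_2) :
  ~ excluded_ray a b z ->
  is_diff z (range_angle a b) (fun v => v *m range_angle_jac a b z).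
Proof.
move=> zray.
pose p (y : 'rV[R]_2) := y 0 0 - a; pose q (y : 'rV[R]_2) := y 0 1 - b.
pose r y := Num.sqrt (p y ^+ 2 + q y ^+ 2).
have pq : ~ (p z <= 0 /\ q z = 0).
  exact/not_excluded_ray.
have r0 : 0 < r z := off_ray_norm_gt0 pq.
have s0 : 0 < r z + p z by apply/off_rayP.
have r2 : r z ^+ 2 = p z ^+ 2 + q z ^+ 2.
  by rewrite sqr_sqrtr ?addr_ge0 ?sqr_ge0.
have dp : is_diff z p (fun v => v 0 0).
  have c := is_diff_coord z 0 0.
  apply: is_diff_eq (is_diffB c (is_diff_cst a z)) _.
  by apply/funext => v; rewrite !fctE subr0.
have dq : is_diff z q (fun v => v 0 1).
  have c := is_diff_coord z 0 1.
  apply: is_diff_eq (is_diffB c (is_diff_cst b z)) _.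
  by apply/funext => v; rewrite !fctE subr0.
have dr : is_diff z r (fun v => (p z * v 0 0 + q z * v 0 1) / r z).
  have d2 := is_diffD (is_diffX 1 dp) (is_diffX 1 dq).
  have p2q2 : 0 < (p ^+ 2 + q ^+ 2) z by rewrite -sqrtr_gt0.
  apply: is_diff_eq (is_diff_comp_derive d2 (is_derive1_sqrt p2q2)) _.
  apply/funext => v; rewrite !fctE -/(r z) /GRing.scale/= !expr1.
  by field; rewrite gt_eqF.
pose t y := q y / (r y + p y).
have dt : is_diff z t (fun v => (v 0 1 * (r z + p z)
    - q z * ((p z * v 0 0 + q z * v 0 1) / r z + v 0 0)) / (r z + p z) ^+ 2).
  have ds := is_diffD dr dp.
  have s1 : (r + p) z != 0 by rewrite gt_eqF.
  have dV : is_derive ((r + p) z) 1 (@GRing.inv R) (- ((r + p) z) ^- 2).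
    have := @is_deriveV R id _ _ 1 s1 (is_derive_id _ _).
    by rewrite /GRing.scale/= mulr1.
  apply: is_diff_eq (is_diffM dq (is_diff_comp_derive ds dV)) _.
  apply/funext => v; rewrite !fctE /GRing.scale/=; field.
  by rewrite !gt_eqF.
have dth : is_diff z (fun y => 2 * atan (t y))
    (fun v => (- q z * v 0 0 + p z * v 0 1) / r z ^+ 2).
  have da := is_diffZ 2 (is_diff_comp_derive dt (is_derive1_atan (t z))).
  apply: is_diff_eq da _; apply/funext => v; rewrite !fctE /GRing.scale/=.
  have -> : 1 + t z ^+ 2 = 2 * r z / (r z + p z).
    by rewrite /t; field: r2; rewrite gt_eqF.
  by field: r2; rewrite !gt_eqF.
(* By continuity r + p stays positive near [z], so there the half-angle expression agrees with
   [polar_angle]. *)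
have dth' : is_diff z (fun y => polar_angle (p y) (q y))
    (fun v => (- q z * v 0 0 + p z * v 0 1) / r z ^+ 2).
  apply: near_eq_is_diff dth.
  have [/differentiable_continuous sc _] := is_diffD dr dp.
  have : \forall y \near z, 0 < (r + p) y.
    exact: cvgr_gt sc _ s0.
  by apply: filterS => y sy; rewrite polar_angle_atan//; apply/off_rayP.
pose dh (i : 'I_2) (v : 'rV[R]_2) := if i == 0
  then (p z * v 0 0 + q z * v 0 1) / r z
  else (- q z * v 0 0 + p z * v 0 1) / r z ^+ 2.
have dhP i : is_diff z (fun y => range_angle a b y 0 i : R) (dh i).
  rewrite /range_angle /dh; under eq_fun do rewrite mxE.
  by case: (i == 0).
apply: is_diff_eq (is_diff_row dhP) _; rewrite /dh.
apply/funext => v; apply/rowP => j; rewrite !mxE big_ord_recl big_ord1 !mxE/=.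
rewrite -/(p z) -/(q z) -/(r z).
have -> : lift ord0 ord0 = 1 :> 'I_2 by apply/val_inj.
by case: (j == 0) => /=; ring.
Qed.

Lemma is_diff_mulmx (R : numFieldType) (n m : nat) (A : 'M[R]_(n, m))
    (z : 'rV[R]_n) :
  is_diff z (fun u : 'rV[R]_n => u *m A) (fun u => u *m A).
Proof.
have dA y : differentiable (mulmxr A : 'rV[R]_n -> 'rV[R]_m) y.
  suff /is_diff_row[] : forall j, is_diff y (fun u => mulmxr A u 0 j : R)
      ('d (fun u => mulmxr A u 0 j : R) y) by [].
  move=> j; apply: differentiableP.
  have -> : (fun u => mulmxr A u 0 j : R) =
      \sum_i (A i j *: (fun u : 'rV[R]_n => u 0 i : R)).
    apply/funext => u; rewrite /= mxE fct_sumE; apply: eq_bigr => i _.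
    by rewrite mulrC.
  by apply: differentiable_sum => i; apply/differentiableZ/differentiable_coord.
apply: DiffDef; first exact: dA.
by apply: (diff_lin (f := mulmxr A)) => y; exact: differentiable_continuous.
Qed.

Lemma jacobianE (R : numFieldType) (n m : nat) (f : 'rV[R]_n -> 'rV[R]_m)
    (z : 'rV[R]_n) (A : 'M[R]_(n, m)) :
  is_diff z f (fun v => v *m A) -> 'J f z = A.
Proof.
move=> [_ fA]; apply/row_matrixP => i.
by rewrite !rowE /jacobian mul_rV_lin1 fA.
Qed.

(** Since [E^T] factors out on the left, the Jacobian determinant of the error is [\det E] times
    that of a difference of two Jacobians of [h]. *)
Lemma is_diff_linearization_error (R : realType) (n m : nat)
    (h : 'rV[R]_n -> 'rV[R]_m) (x u : 'rV[R]_n) (E : 'M[R]_n)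
    (A : 'M[R]_(n, m)) :
  is_diff (x + u *m E^T) h (fun v => v *m A) ->
  is_diff u (linearization_error h x E) (fun v => v *m (E^T *m (A - 'J h x))).
Proof.
move=> hA; have dE := is_diff_mulmx E^T u.
have dy : is_diff u (fun v => x + v *m E^T) (fun v => v *m E^T).
  apply: is_diff_eq (is_diffD (is_diff_cst x u) dE) _.
  by apply/funext => v; rewrite fctE add0r.
have dJ : is_diff u (fun v => v *m E^T *m 'J h x) (fun v => v *m E^T *m 'J h x).
  have dJ := is_diff_mulmx ('J h x) (u *m E^T).
  exact: is_diff_comp dE dJ.
apply: is_diff_eq (is_diffB (is_diffB (is_diff_comp dy hA)
  (is_diff_cst (h x) u)) dJ) _.
by apply/funext => v; rewrite !fctE subr0 !mulmxBr !mulmxA.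
Qed.

(** * Determinants and plane geometry *)

Lemma enormZ (R : realType) (n : nat) (k : R) (v : 'rV[R]_n) :
  enorm (k *: v) = `|k| * enorm v.
Proof.
rewrite /enorm -sqrtr_sqr -sqrtrM ?sqr_ge0// mulr_sumr.
by congr Num.sqrt; apply: eq_bigr => i _; rewrite mxE exprMn.
Qed.

Lemma det_mx2 (R : comNzRingType) (A : 'M[R]_2) :
  \det A = A 0 0 * A 1 1 - A 0 1 * A 1 0.
Proof.
rewrite (expand_det_row _ 0) big_ord_recl big_ord1 /cofactor !det_mx11 !mxE.
have -> : lift ord0 ord0 = 1 :> 'I_2 by apply/val_inj.
have -> : lift 1 0 = 0 :> 'I_2 by apply/val_inj.
by rewrite /= add0n expr0 expr1; ring.
Qed.

Lemma det_range_angle_jacB (R : realType) (a b : R) (x y : 'rV[R]_2) :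
  ~ excluded_ray a b x -> ~ excluded_ray a b y ->
  let p := x 0 0 - a in let q := x 0 1 - b in
  let p' := y 0 0 - a in let q' := y 0 1 - b in
  let r := Num.sqrt (p ^+ 2 + q ^+ 2) in
  let r' := Num.sqrt (p' ^+ 2 + q' ^+ 2) in
  \det (range_angle_jac a b y - range_angle_jac a b x) =
  (r + r') / (r * r') ^+ 2 * (r * r' - (p * p' + q * q')).
Proof.
move=> /not_excluded_ray xray /not_excluded_ray yray p q p' q' r r'.
have r0 : 0 < r := off_ray_norm_gt0 xray.
have r'0 : 0 < r' := off_ray_norm_gt0 yray.
have r2 : r ^+ 2 = p ^+ 2 + q ^+ 2 by rewrite sqr_sqrtr ?addr_ge0 ?sqr_ge0.
have r'2 : r' ^+ 2 = p' ^+ 2 + q' ^+ 2 by rewrite sqr_sqrtr ?addr_ge0 ?sqr_ge0.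
rewrite det_mx2 !mxE /= -/p -/q -/p' -/q' -/r -/r'.
by field: r2 r'2; rewrite !gt_eqF.
Qed.

(** Expansion of the squared norm of r' v - r v', for v = (p, q) and v' = (p', q'). It gives both
    the Cauchy-Schwarz inequality and its equality case r' v = r v'. *)
Lemma norm_dot_defect (R : realType) (p q p' q' : R) :
  let r := Num.sqrt (p ^+ 2 + q ^+ 2) in
  let r' := Num.sqrt (p' ^+ 2 + q' ^+ 2) in
  2 * (r * r') * (r * r' - (p * p' + q * q')) =
  (r' * p - r * p') ^+ 2 + (r' * q - r * q') ^+ 2.
Proof.
have := sqr_sqrtr (addr_ge0 (sqr_ge0 p) (sqr_ge0 q)).
have := sqr_sqrtr (addr_ge0 (sqr_ge0 p') (sqr_ge0 q')).
by move=> r'2 r2 r r'; rewrite -/r -/r' in r2 r'2; ring: r2 r'2.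
Qed.

(* If the vectors were antiparallel, the segment between them would contain the
   origin, which lies on the ray. *)
Lemma dot_eq_norm (R : realType) (p q p' q' : R) :
  (forall t, 0 <= t <= 1 ->
    ~ (p + t * (p' - p) <= 0 /\ q + t * (q' - q) = 0)) ->
  q * (p' - p) - p * (q' - q) = 0 ->
  p * p' + q * q' = Num.sqrt (p ^+ 2 + q ^+ 2) * Num.sqrt (p' ^+ 2 + q' ^+ 2).
Proof.
move=> seg cross.
have pq : ~ (p <= 0 /\ q = 0).
  by have := seg 0; rewrite !mul0r !addr0; apply; rewrite lexx ler01.
have pq' : ~ (p' <= 0 /\ q' = 0).
  by have := seg 1; rewrite !mul1r !subrKC; apply; rewrite lexx ler01.
have := off_ray_norm_gt0 pq; have := off_ray_norm_gt0 pq'.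
have := sqr_sqrtr (addr_ge0 (sqr_ge0 p) (sqr_ge0 q)).
have := sqr_sqrtr (addr_ge0 (sqr_ge0 p') (sqr_ge0 q')).
set r := Num.sqrt (p ^+ 2 + _); set r' := Num.sqrt (p' ^+ 2 + _).
move=> r'2 r2 r'0 r0.
(* Lagrange's identity: squared dot product plus squared cross product is (r r')^2. *)
have : (p * p' + q * q') ^+ 2 == (r * r') ^+ 2.
  apply/eqP; rewrite exprMn r2 r'2.
  transitivity ((p * p' + q * q') ^+ 2 + (q * (p' - p) - p * (q' - q)) ^+ 2).
    by rewrite cross expr0n addr0.
  by ring.
rewrite eqf_sqr => /orP[/eqP//|/eqP anti]; exfalso.
have : (r' * p + r * p') ^+ 2 + (r' * q + r * q') ^+ 2 = 0.
  by rewrite -(mulr0 (2 * (r * r'))) -(addNr (r * r')) -anti; ring: r2 r'2.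
move/eqP; rewrite paddr_eq0 ?sqr_ge0// !sqrf_eq0 => /andP[/eqP zp /eqP zq].
have rr' : r + r' != 0 by rewrite gt_eqF ?addr_gt0.
(* For opposite directions the origin divides the segment in the ratio r : r'. *)
apply: (seg (r / (r + r'))).
  by rewrite divr_ge0 ?ler_pdivrMr ?addr_gt0 ?addr_ge0 ?mul1r ?lerDl// ltW.
have -> : p + r / (r + r') * (p' - p) = (r' * p + r * p') / (r + r') by field.
have -> : q + r / (r + r') * (q' - q) = (r' * q + r * q') / (r + r') by field.
by rewrite zp zq mul0r.
Qed.

Theorem lemma4p5 (R : realType) (a b : R) (x : 'rV[R]_2) (P E : 'M[R]_2)
    (hP : posdefmx P) (hE : cholesky_factor E P)
    (hray : [set x + u *m E^T | u in @closed_unit_ball R 2]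
              `&` excluded_ray a b = set0) :
  let g := linearization_error (range_angle a b) x E in
  let c := E 0 0 * (x 0 1 - b) - E 1 0 * (x 0 0 - a) in
  let d := E 0 1 * (x 0 1 - b) - E 1 1 * (x 0 0 - a) in
  forall u : 'rV[R]_2, enorm u <= 1 ->
    [/\ differentiable g u,
        0 <= \det ('J g u),
        \det ('J g u) = 0 <-> c * u 0 0 + d * u 0 1 = 0 &
        c * u 0 0 + d * u 0 1 = 0 -> g u = 0].
Proof.
move=> g c d u u1.
have [/is_trig_mxP Etrig Epos _] := hE.
(* The ball is star-shaped about 0, so the whole segment from [x] to x + E u avoids the ray. *)
have seg t : 0 <= t <= 1 -> ~ excluded_ray a b (x + (t *: u) *m E^T).
  move=> /andP[t0 t1] tray; rewrite -[False]/(set0 (x + (t *: u) *m E^T)) -hray.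
  split=> //; exists (t *: u) => //.
  rewrite /closed_unit_ball /= enormZ ger0_norm//.
  by rewrite (le_trans (ler_piMl _ t1))// sqrtr_ge0.
set y := x + u *m E^T.
have xray : ~ excluded_ray a b x.
  by have := seg 0; rewrite scale0r mul0mx addr0; apply; rewrite lexx ler01.
have yray : ~ excluded_ray a b y.
  by have := seg 1; rewrite scale1r; apply; rewrite ler01 lexx.
have Jx := jacobianE (is_diff_range_angle xray).
have gdiff := is_diff_linearization_error (is_diff_range_angle yray).
have detE : 0 < \det E.
  by rewrite det_mx2 (Etrig 0 1)// mul0r subr0 mulr_gt0.
pose p := x 0 0 - a; pose q := x 0 1 - b.
pose p' := y 0 0 - a; pose q' := y 0 1 - b.
pose r := Num.sqrt (p ^+ 2 + q ^+ 2); pose r' := Num.sqrt (p' ^+ 2 + q' ^+ 2).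
have pq : ~ (p <= 0 /\ q = 0) by exact/not_excluded_ray.
have pq' : ~ (p' <= 0 /\ q' = 0) by exact/not_excluded_ray.
have r0 : 0 < r := off_ray_norm_gt0 pq.
have r'0 : 0 < r' := off_ray_norm_gt0 pq'.
have r2 : r ^+ 2 = p ^+ 2 + q ^+ 2 by rewrite sqr_sqrtr ?addr_ge0 ?sqr_ge0.
have r'2 : r' ^+ 2 = p' ^+ 2 + q' ^+ 2 by rewrite sqr_sqrtr ?addr_ge0 ?sqr_ge0.
have sum2 (F : 'I_2 -> R) : \sum_i F i = F 0 + F 1.
  by rewrite big_ord_recl big_ord1; congr (_ + F _); apply/val_inj.
have dp : p' - p = (u *m E^T) 0 0 by rewrite /p' /p /y mxE; ring.
have dq : q' - q = (u *m E^T) 0 1 by rewrite /q' /q /y mxE; ring.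
have cross : c * u 0 0 + d * u 0 1 = q * (p' - p) - p * (q' - q).
  by rewrite dp dq !mxE !sum2 !mxE /c /d -/p -/q; ring.
have defect : 2 * (r * r') * (r * r' - (p * p' + q * q')) =
    (r' * p - r * p') ^+ 2 + (r' * q - r * q') ^+ 2 :=
  norm_dot_defect p q p' q'.
have detJ : \det ('J g u) =
    \det E * ((r + r') / (r * r') ^+ 2 * (r * r' - (p * p' + q * q'))).
  by rewrite (jacobianE gdiff) det_mulmx det_tr Jx det_range_angle_jacB.
have k0 : 0 < (r + r') / (r * r') ^+ 2.
  by rewrite divr_gt0 ?addr_gt0// exprn_gt0// mulr_gt0.
have rr'0 : 0 < 2 * (r * r') by rewrite !mulr_gt0.
have aligned : c * u 0 0 + d * u 0 1 = 0 -> r * r' - (p * p' + q * q') = 0.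
  rewrite cross => cr; apply/eqP; rewrite subr_eq0; apply/eqP/esym.
  apply: dot_eq_norm cr => t /seg /not_excluded_ray; apply: contra_not.
  by rewrite dp dq -scalemxAl /p /q !mxE => -[H1 H2]; split; lra.
split.
- by case: gdiff.
- rewrite detJ mulr_ge0 ?(ltW detE)// mulr_ge0 ?(ltW k0)//.
  (* Multiplied by the positive factor 2 r r', the defect becomes a sum of two squares. *)
  by rewrite -(pmulr_rge0 _ rr'0) defect addr_ge0 ?sqr_ge0.
- rewrite detJ; split=> [/eqP|/aligned->]; last by rewrite !mulr0.
  rewrite mulf_eq0 (gt_eqF detE)/= mulf_eq0 (gt_eqF k0)/= => /eqP dot.
  move: defect; rewrite dot mulr0 => /esym/eqP.
  rewrite paddr_eq0 ?sqr_ge0// !sqrf_eq0 => /andP[/eqP ep /eqP eq].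
  rewrite cross; apply: (mulfI (lt0r_neq0 r0)); rewrite mulr0.
  (* r times the cross product is a combination of the coordinates of r' v - r v', which vanish
     here. *)
  transitivity (p * (r' * q - r * q') - q * (r' * p - r * p')); first by ring.
  by rewrite ep eq !mulr0 subrr.
- move=> /[dup] /aligned dot; rewrite cross => cr.
  move: defect; rewrite dot mulr0 => /esym/eqP.
  rewrite paddr_eq0 ?sqr_ge0// !sqrf_eq0 => /andP[/eqP ep /eqP eq].
  (* The two vectors differ by the positive factor r' / r; the half-angle quotient q / (r + p) is
     homogeneous of degree 0, so the angles agree. *)
  have pE : p' = r' / r * p.
    by apply: (mulfI (lt0r_neq0 r0)); rewrite mulrA mulrCA divff ?gt_eqF//; lra.
  have qE : q' = r' / r * q.
    by apply: (mulfI (lt0r_neq0 r0)); rewrite mulrA mulrCA divff ?gt_eqF//; lra.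
  have s0 : 0 < r + p by apply/off_rayP.
  have s'0 : 0 < r' + p' by apply/off_rayP.
  have angle : polar_angle p' q' = polar_angle p q.
    rewrite !polar_angle_atan// -/r -/r'; congr (2 * atan _).
    apply/eqP; rewrite (eqr_div _ _ (lt0r_neq0 s'0) (lt0r_neq0 s0)) pE qE.
    by apply/eqP; field; rewrite gt_eqF.
  have wE (A : 'M[R]_2) j : (u *m E^T *m A) 0 j =
      (p' - p) * A 0 j + (q' - q) * A 1 j.
    by rewrite mxE sum2 dp dq.
  have subE (A B : 'rV[R]_2) j : (A - B) 0 j = A 0 j - B 0 j by rewrite !mxE.
  apply/rowP => j; rewrite /g /linearization_error -/y Jx !subE wE.
  clearbody y; rewrite !mxE.
  rewrite -/p -/q -/p' -/q' -/r -/r'.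
  case: (j == 0) => /=.
    (* Range component: with v . v' = r r' the linear term is (r r' - r^2) / r = r' - r. *)
    transitivity (r' - r - (p * p' + q * q' - (p ^+ 2 + q ^+ 2)) / r).
      by ring.
    by rewrite -r2 -(subr0_eq dot); field; rewrite gt_eqF.
  rewrite angle subrr.
  (* Angle component: only the linear term is left, and it is a multiple of the vanishing cross
     product. *)
  transitivity ((q * (p' - p) - p * (q' - q)) / r ^+ 2); first by ring.
  by rewrite cr mul0r.
Qed.
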